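(* In the effective topos $\mathbf{Eff}$, let $F:(Y,\approx)\to(X,\sim)$ be a morphism such that $(Y,\approx)$ is $\neg\neg$-separated. If $F$ is a trivial fibration, then $F$ is a uniform map.
   Context: $\mathbf{Eff}$ is Hyland's effective topos: objects are pairs $(X,\sim)$ with $[\cdot\sim\cdot]:X\times X\to\mathcal{P}(\omega)$ a partial equivalence relation with uniform partial recursive realizers for symmetry and transitivity; morphisms are equivalence classes of $\mathcal{P}(\omega)$-valued functional relations. $\Gamma=\mathrm{Hom}(1,-):\mathbf{Eff}\to\mathbf{Set}$ is left adjoint to $\nabla:\mathbf{Set}\to\mathbf{Eff}$, where $\nabla X=(X,\sim)$ with $[x\sim x']=\omega$ if $x=x'$, $\emptyset$ otherwise; $\eta_X:X\to\nabla\Gamma X$ is the unit. An object $(Y,\approx)$ is $\neg\neg$-separated if there is a partial recursive $\phi$ such that whenever $[y\approx y']\neq\emptyset$, $n\in[y\approx y]$, $m\in[y'\approx y']$, then $\phi(n,m)\in[y\approx y']$. A map $F:Y\to X$ is uniform if there is a set $Z$ and a function $\alpha:Z\to\Gamma X$ such that, letting $S:X\times_{\nabla\Gamma X}\nabla Z\to X$ be the pullback of $\nabla\alpha$ along $\eta_X$, there is an epimorphism $R:X\times_{\nabla\Gamma X}\nabla Z\to Y$ with $FR=S$. A trivial fibration is a map with the right lifting property against all monomorphisms of $\mathbf{Eff}$. *)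

(* Defs.v *)
From Stdlib Require Import Arith Cantor.
From Stdlib Require Import FunctionalExtensionality PropExtensionality ProofIrrelevance.
From Stdlib Require Import ClassicalEpsilon.

(* The class of unary partial recursive functions, generated over the Cantor
   pairing; a k-ary function is recursive when it is so on coded tuples. *)
Definition pr (a b : nat) : nat := Cantor.to_nat (a, b).
Definition p1 (n : nat) : nat := fst (Cantor.of_nat n).
Definition p2 (n : nat) : nat := snd (Cantor.of_nat n).

Inductive code : Set :=
| Zero | Succ | Fst | Snd
| Pair (f g : code)
| Comp (f g : code)
| Prec (f g : code)
| Mu (f : code).

(* [eval c n m] : the partial function coded by [c] is defined at [n], with
   value [m].  [Prec f g] at (a, k) is the k-th term of the sequence
   v 0 = f a, v (i+1) = g (a, (i, v i)); [Mu f] at n is the least m with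
   f (n, m) = 0, all f (n, k) with k < m being defined and nonzero. *)
Fixpoint eval (c : code) : nat -> nat -> Prop :=
  match c with
  | Zero => fun _ m => m = 0
  | Succ => fun n m => m = S n
  | Fst => fun n m => m = p1 n
  | Snd => fun n m => m = p2 n
  | Pair f g => fun n m => exists a b, eval f n a /\ eval g n b /\ m = pr a b
  | Comp f g => fun n m => exists a, eval g n a /\ eval f a m
  | Prec f g => fun n =>
      (fix rec (k : nat) (m : nat) {struct k} : Prop :=
         match k with
         | 0 => eval f (p1 n) m
         | S i => exists v, rec i v /\ eval g (pr (p1 n) (pr i v)) m
         end) (p2 n)
  | Mu f => fun n m =>
      eval f (pr n m) 0 /\ forall k, k < m -> exists v, eval f (pr n k) (S v)
  end.

Lemma p1_pr a b : p1 (pr a b) = a.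
Proof. unfold p1, pr. now rewrite Cantor.cancel_of_to. Qed.

Lemma p2_pr a b : p2 (pr a b) = b.
Proof. unfold p2, pr. now rewrite Cantor.cancel_of_to. Qed.

Lemma pr_p n : pr (p1 n) (p2 n) = n.
Proof. unfold p1, p2, pr. rewrite <- surjective_pairing. apply Cantor.cancel_to_of. Qed.

Lemma eval_det c n m m' : eval c n m -> eval c n m' -> m = m'.
Proof.
  revert n m m'. induction c; simpl; intros n m m'; try congruence.
  - intros (a & b & Ha & Hb & ->) (a' & b' & Ha' & Hb' & ->).
    f_equal; eauto.
  - intros (a & Ha & Hb) (a' & Ha' & Hb').
    assert (a = a') by eauto. subst; eauto.
  - generalize (p2 n). intros k. revert m m'. induction k as [|k IH].
    + eauto.
    + intros m m' (v & Hv & Hm) (v' & Hv' & Hm').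
      assert (v = v') by eauto. subst; eauto.
  - intros [H0 H1] [H0' H1'].
    destruct (Nat.lt_trichotomy m m') as [L|[L|L]]; trivial; exfalso.
    + destruct (H1' _ L) as [v Hv]. now assert (0 = S v) by eauto.
    + destruct (H1 _ L) as [v Hv]. now assert (0 = S v) by eauto.
Qed.

Definition pset := nat -> Prop.

Definition pand (P Q : pset) : pset := fun n => P (p1 n) /\ Q (p2 n).
Definition pex {J : Type} (P : J -> pset) : pset := fun n => exists j, P j n.

Definition realizes (c : code) (n : nat) (Q : pset) : Prop :=
  exists m, eval c n m /\ Q m.

(* One partial recursive function works uniformly for all indices [i]. *)
Definition ent {I : Type} (P Q : I -> pset) : Prop :=
  exists c, forall i n, P i n -> realizes c n (Q i).

Definition Id : code := Pair Fst Snd.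

Lemma r_id n (Q : pset) : Q n -> realizes Id n Q.
Proof.
  intros H. exists n. split; trivial. exists (p1 n), (p2 n).
  repeat split. now rewrite pr_p.
Qed.

Lemma r_pair f g n P Q :
  realizes f n P -> realizes g n Q -> realizes (Pair f g) n (pand P Q).
Proof.
  intros (a & Ha & HP) (b & Hb & HQ). exists (pr a b). split.
  - now exists a, b.
  - unfold pand. now rewrite p1_pr, p2_pr.
Qed.

Lemma r_comp f g n (P Q : pset) :
  (forall a, P a -> realizes f a Q) -> realizes g n P -> realizes (Comp f g) n Q.
Proof.
  intros Hf (a & Ha & HP). destruct (Hf a HP) as (m & Hm & HQ).
  exists m. split; trivial. now exists a.
Qed.

Lemma r_fst c n P Q : realizes c n (pand P Q) -> realizes (Comp Fst c) n P.
Proof. apply r_comp. intros a [H _]. now exists (p1 a). Qed.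

Lemma r_snd c n P Q : realizes c n (pand P Q) -> realizes (Comp Snd c) n Q.
Proof. apply r_comp. intros a [_ H]. now exists (p2 a). Qed.

Lemma r_ex {J} c n (P : J -> pset) j : realizes c n (P j) -> realizes c n (pex P).
Proof. intros (m & Hm & HP). exists m. split; trivial. now exists j. Qed.

Lemma r_ex_inv {J} c n (P : J -> pset) :
  realizes c n (pex P) -> exists j, realizes c n (P j).
Proof. intros (m & Hm & j & HP). exists j. now exists m. Qed.

Lemma r_sub c n (P Q : pset) : (forall m, P m -> Q m) -> realizes c n P -> realizes c n Q.
Proof. intros S (m & Hm & HP). exists m; auto. Qed.

Lemma ent_trans {I} (P Q R : I -> pset) : ent P Q -> ent Q R -> ent P R.
Proof.
  intros [c Hc] [d Hd]. exists (Comp d c). intros i n H.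
  apply (r_comp d c n (Q i)); auto.
Qed.

Lemma ent_refl {I} (P : I -> pset) : ent P P.
Proof. exists Id. intros i n. apply r_id. Qed.

Fixpoint Const (k : nat) : code :=
  match k with 0 => Zero | S k => Comp Succ (Const k) end.

Lemma r_const k n (Q : pset) : Q k -> realizes (Const k) n Q.
Proof.
  intros H. exists k. split; trivial. clear H.
  induction k as [|k IH]; simpl; eauto.
Qed.

Record Eff : Type := MkEff {
  car :> Type;
  eqv : car -> car -> pset;
  eqv_sym : ent (fun '(x, y) => eqv x y) (fun '(x, y) => eqv y x);
  eqv_trans : ent (fun '(x, y, z) => pand (eqv x y) (eqv y z))
                  (fun '(x, y, z) => eqv x z)
}.
Arguments eqv {_} _ _ _.
Arguments eqv_sym _ : clear implicits.
Arguments eqv_trans _ : clear implicits.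


Section Relations.
Context {X Y : Eff} (R : X -> Y -> pset).

Definition strict : Prop :=
  ent (fun '(x, y) => R x y) (fun '(x, y) => pand (eqv x x) (eqv y y)).

Definition extensional : Prop :=
  ent (fun '(x, y, x', y') => pand (R x y) (pand (eqv x x') (eqv y y')))
      (fun '(x, y, x', y') => R x' y').

Definition single_valued : Prop :=
  ent (fun '(x, y, y') => pand (R x y) (R x y')) (fun '(x, y, y') => eqv y y').

Definition total : Prop :=
  ent (fun x => eqv x x) (fun x => pex (fun y => R x y)).

End Relations.

Record FunRel (X Y : Eff) : Type := MkFunRel {
  rel :> X -> Y -> pset;
  rel_strict : strict rel;
  rel_ext : extensional rel;
  rel_sv : single_valued rel;
  rel_total : total rel
}.
Arguments MkFunRel {X Y} _ _ _ _ _.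
Arguments rel {X Y} _ _ _ _.

Definition fr_equiv {X Y : Eff} (F G : FunRel X Y) : Prop :=
  ent (fun '(x, y) => F x y) (fun '(x, y) => G x y) /\
  ent (fun '(x, y) => G x y) (fun '(x, y) => F x y).

(* A morphism is an equivalence class of functional relations, so that equality
   of morphisms is [=]. *)
Record Hom (X Y : Eff) : Type := MkHom {
  hcls :> FunRel X Y -> Prop;
  hcls_class : exists F, hcls = fr_equiv F
}.
Arguments hcls {X Y} _ _.
Arguments hcls_class {X Y} _.

Definition cls {X Y : Eff} (F : FunRel X Y) : Hom X Y :=
  MkHom X Y (fr_equiv F) (ex_intro _ F eq_refl).

Lemma fr_equiv_refl {X Y : Eff} (F : FunRel X Y) : fr_equiv F F.
Proof. split; apply ent_refl. Qed.

Lemma fr_equiv_sym {X Y : Eff} (F G : FunRel X Y) : fr_equiv F G -> fr_equiv G F.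
Proof. intros [? ?]; now split. Qed.

Lemma fr_equiv_trans {X Y : Eff} (F G H : FunRel X Y) :
  fr_equiv F G -> fr_equiv G H -> fr_equiv F H.
Proof. intros [? ?] [? ?]; split; eapply ent_trans; eauto. Qed.

Lemma hom_eq {X Y : Eff} (f g : Hom X Y) : (forall F, f F <-> g F) -> f = g.
Proof.
  destruct f as [f Hf], g as [g Hg]; simpl; intros H.
  assert (f = g) as <-.
  { extensionality F. apply propositional_extensionality, H. }
  f_equal. apply proof_irrelevance.
Qed.

Lemma cls_eq {X Y : Eff} (F G : FunRel X Y) : cls F = cls G <-> fr_equiv F G.
Proof.
  split.
  - intros H. change (cls F G). rewrite H. apply fr_equiv_refl.
  - intros H. apply hom_eq. intros K; simpl. split; intros HK.
    + eapply fr_equiv_trans; [apply fr_equiv_sym|]; eauto.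
    + eapply fr_equiv_trans; eauto.
Qed.

Lemma hom_cls {X Y : Eff} (f : Hom X Y) : exists F, f = cls F.
Proof.
  destruct (hcls_class f) as [F HF]. exists F. apply hom_eq.
  intros G. now rewrite HF.
Qed.


Lemma use_sym (X : Eff) : exists s, forall c n (x y : X),
  realizes c n (eqv x y) -> realizes (Comp s c) n (eqv y x).
Proof. destruct (eqv_sym X) as [s H]. exists s. intros c n x y. apply r_comp, (H (x, y)). Qed.

Lemma use_trans (X : Eff) : exists t, forall c d n (x y z : X),
  realizes c n (eqv x y) -> realizes d n (eqv y z) ->
  realizes (Comp t (Pair c d)) n (eqv x z).
Proof.
  destruct (eqv_trans X) as [t H]. exists t. intros c d n x y z H1 H2.
  eapply r_comp; [apply (H (x, y, z))|]. now apply r_pair.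
Qed.

Lemma use_refl (X : Eff) : exists l r, forall c n (x y : X), realizes c n (eqv x y) ->
  realizes (Comp l c) n (eqv x x) /\ realizes (Comp r c) n (eqv y y).
Proof.
  destruct (use_sym X) as [s Hs], (use_trans X) as [t Ht]. do 2 eexists.
  intros c n x y H. split.
  - eapply r_comp; [|apply H]. intros a Ha. apply r_id in Ha.
    eapply Ht; [apply Ha|apply Hs, Ha].
  - eapply r_comp; [|apply H]. intros a Ha. apply r_id in Ha.
    eapply Ht; [apply Hs, Ha|apply Ha].
Qed.

Section UseRel.
Context {X Y : Eff} (F : FunRel X Y).

Lemma use_strict : exists l r, forall c n x y, realizes c n (F x y) ->
  realizes (Comp l c) n (eqv x x) /\ realizes (Comp r c) n (eqv y y).
Proof.
  destruct (rel_strict _ _ F) as [s H]. exists (Comp Fst s), (Comp Snd s).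
  intros c n x y HF. split; (eapply r_comp; [|apply HF]); intros a Ha.
  - eapply r_fst, (H (x, y)), Ha.
  - eapply r_snd, (H (x, y)), Ha.
Qed.

Lemma use_ext : exists e, forall c d d' n x y x' y',
  realizes c n (F x y) -> realizes d n (eqv x x') -> realizes d' n (eqv y y') ->
  realizes (Comp e (Pair c (Pair d d'))) n (F x' y').
Proof.
  destruct (rel_ext _ _ F) as [e H]. exists e. intros c d d' n x y x' y' H1 H2 H3.
  eapply r_comp; [apply (H (x, y, x', y'))|]. now repeat apply r_pair.
Qed.

Lemma use_sv : exists e, forall c d n x y y',
  realizes c n (F x y) -> realizes d n (F x y') ->
  realizes (Comp e (Pair c d)) n (eqv y y').
Proof.
  destruct (rel_sv _ _ F) as [e H]. exists e. intros c d n x y y' H1 H2.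
  eapply r_comp; [apply (H (x, y, y'))|]. now apply r_pair.
Qed.

Lemma use_total : exists e, forall c n x, realizes c n (eqv x x) ->
  exists y, realizes (Comp e c) n (F x y).
Proof.
  destruct (rel_total _ _ F) as [e H]. exists e. intros c n x Hx.
  apply r_ex_inv. eapply r_comp; [apply H|apply Hx].
Qed.
End UseRel.

Lemma use_ent {X Y : Eff} (F G : X -> Y -> pset) :
  ent (fun '(x, y) => F x y) (fun '(x, y) => G x y) ->
  exists e, forall c n x y, realizes c n (F x y) -> realizes (Comp e c) n (G x y).
Proof. intros [e H]. exists e. intros c n x y. apply r_comp, (H (x, y)). Qed.

Ltac rstart :=
  eexists; intros i n; repeat match goal with i : prod _ _ |- _ => destruct i end;
  intros Hn; apply r_id in Hn.

Ltac rsplit := repeat match goal with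
  | H : realizes _ _ (pand _ _) |- _ =>
      let H1 := fresh "H" in let H2 := fresh "H" in
      pose proof (r_fst _ _ _ _ H) as H1; pose proof (r_snd _ _ _ _ H) as H2; clear H
  | H : realizes _ _ (pex _) |- _ => apply r_ex_inv in H; destruct H as [? H]
  end.

Lemma id_strict (X : Eff) : strict (@eqv X).
Proof.
  destruct (use_refl X) as (l & r & H). rstart.
  apply r_pair; [apply (H _ _ _ _ Hn)|apply (H _ _ _ _ Hn)].
Qed.

Lemma id_ext (X : Eff) : extensional (@eqv X).
Proof.
  destruct (use_sym X) as [s Hs], (use_trans X) as [t Ht]. rstart. rsplit.
  eapply Ht; [apply Hs; exact H1|]. eapply Ht; [exact H|exact H2].
Qed.

Lemma id_sv (X : Eff) : single_valued (@eqv X).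
Proof.
  destruct (use_sym X) as [s Hs], (use_trans X) as [t Ht]. rstart. rsplit.
  eapply Ht; [apply Hs; eassumption|]. eassumption.
Qed.

Lemma id_total (X : Eff) : total (@eqv X).
Proof. rstart. eapply r_ex, Hn. Qed.

Definition fr_id (X : Eff) : FunRel X X :=
  MkFunRel eqv (id_strict X) (id_ext X) (id_sv X) (id_total X).

Definition hid (X : Eff) : Hom X X := cls (fr_id X).

Section Composition.
Context {X Y Z : Eff} (G : FunRel Y Z) (F : FunRel X Y).

Definition rcomp (x : X) (z : Z) : pset := pex (fun y => pand (F x y) (G y z)).

Lemma comp_strict : strict rcomp.
Proof.
  destruct (use_strict F) as (l & r & HF), (use_strict G) as (l' & r' & HG).
  rstart. unfold rcomp in Hn. rsplit.
  apply r_pair; [eapply HF|eapply HG]; eassumption.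
Qed.

Lemma comp_ext : extensional rcomp.
Proof.
  destruct (use_ext F) as (e & HF), (use_ext G) as (e' & HG).
  destruct (use_strict F) as (l & r & HS).
  rstart. unfold rcomp in *. rsplit.
  eapply r_ex, r_pair.
  - eapply HF; try eassumption. eapply HS; eassumption.
  - eapply HG; try eassumption. eapply HS; eassumption.
Qed.

Lemma comp_sv : single_valued rcomp.
Proof.
  destruct (use_sv F) as (e & HF), (use_sv G) as (e' & HG), (use_ext G) as (a & HE).
  destruct (use_strict G) as (l & r & HS).
  rstart. unfold rcomp in *. rsplit.
  eapply HG; [|eassumption].
  eapply HE; [eassumption| |eapply HS; eassumption].
  eapply HF; eassumption.
Qed.

Lemma comp_total : total rcomp.
Proof.
  destruct (use_total F) as (e & HF), (use_total G) as (e' & HG).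
  destruct (use_strict F) as (l & r & HS).
  rstart. destruct (HF _ _ _ Hn) as [y Hy].
  destruct (HG _ _ _ (proj2 (HS _ _ _ _ Hy))) as [z Hz].
  eapply r_ex, r_ex, r_pair; eassumption.
Qed.

Definition fr_comp : FunRel X Z :=
  MkFunRel rcomp comp_strict comp_ext comp_sv comp_total.
End Composition.

Lemma fr_comp_equiv {X Y Z : Eff} (G G' : FunRel Y Z) (F F' : FunRel X Y) :
  fr_equiv G G' -> fr_equiv F F' -> fr_equiv (fr_comp G F) (fr_comp G' F').
Proof.
  intros [G1 G2] [F1 F2].
  apply use_ent in G1, G2, F1, F2.
  destruct G1 as [g1 G1], G2 as [g2 G2], F1 as [f1 F1], F2 as [f2 F2].
  split; rstart; cbn in *; unfold rcomp in *; rsplit; eapply r_ex, r_pair; eauto.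
Qed.

Definition comp {X Y Z : Eff} (g : Hom Y Z) (f : Hom X Y) : Hom X Z.
Proof.
  refine (MkHom X Z (fun H => exists G F, g G /\ f F /\ fr_equiv (fr_comp G F) H) _).
  abstract (
    destruct (hom_cls g) as [G ->], (hom_cls f) as [F ->]; exists (fr_comp G F);
    extensionality H; apply propositional_extensionality; split;
    [ intros (G' & F' & HG & HF & E); eapply fr_equiv_trans; [|apply E];
      apply fr_comp_equiv; assumption
    | intros E; exists G, F; repeat split; try apply fr_equiv_refl; apply E ]).
Defined.

Declare Scope eff_scope.
Open Scope eff_scope.
Infix "∘" := comp (at level 40, left associativity) : eff_scope.

Lemma comp_cls {X Y Z : Eff} (G : FunRel Y Z) (F : FunRel X Y) :
  cls G ∘ cls F = cls (fr_comp G F).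
Proof.
  apply hom_eq. intros H; simpl. split.
  - intros (G' & F' & HG & HF & E). eapply fr_equiv_trans; [|apply E].
    now apply fr_comp_equiv.
  - intros E. exists G, F. repeat split; try apply ent_refl; apply E.
Qed.

Lemma comp_id_l {X Y : Eff} (f : Hom X Y) : hid Y ∘ f = f.
Proof.
  destruct (hom_cls f) as [F ->]. unfold hid. rewrite comp_cls. apply cls_eq.
  destruct (use_ext F) as (e & HE), (use_strict F) as (l & r & HS).
  split; rstart; cbn in *; unfold rcomp in *; rsplit.
  - eapply HE; [eassumption|eapply HS|]; eassumption.
  - eapply r_ex, r_pair; [|eapply HS]; eassumption.
Qed.

Lemma comp_id_r {X Y : Eff} (f : Hom X Y) : f ∘ hid X = f.
Proof.
  destruct (hom_cls f) as [F ->]. unfold hid. rewrite comp_cls. apply cls_eq.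
  destruct (use_ext F) as (e & HE), (use_strict F) as (l & r & HS), (use_sym X) as [s Hs].
  split; rstart; cbn in *; unfold rcomp in *; rsplit.
  - eapply HE; [eassumption|apply Hs|eapply HS]; eassumption.
  - eapply r_ex, r_pair; [eapply HS|]; eassumption.
Qed.

Lemma comp_assoc {X Y Z W : Eff} (h : Hom Z W) (g : Hom Y Z) (f : Hom X Y) :
  h ∘ (g ∘ f) = h ∘ g ∘ f.
Proof.
  destruct (hom_cls f) as [F ->], (hom_cls g) as [G ->], (hom_cls h) as [H ->].
  rewrite !comp_cls. apply cls_eq.
  split; rstart; cbn in *; unfold rcomp in *; cbn in *; unfold rcomp in *; rsplit.
  - eapply r_ex, r_pair; [eassumption|]. eapply r_ex, r_pair; eassumption.
  - eapply r_ex, r_pair; [|eassumption]. eapply r_ex, r_pair; eassumption.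
Qed.

Definition mono {X Y : Eff} (f : Hom X Y) : Prop :=
  forall (W : Eff) (g h : Hom W X), f ∘ g = f ∘ h -> g = h.

Definition epi {X Y : Eff} (f : Hom X Y) : Prop :=
  forall (W : Eff) (g h : Hom Y W), g ∘ f = h ∘ f -> g = h.

Definition is_pullback {P X W V : Eff} (f : Hom X V) (g : Hom W V)
    (p : Hom P X) (q : Hom P W) : Prop :=
  f ∘ p = g ∘ q /\
  forall (A : Eff) (a : Hom A X) (b : Hom A W), f ∘ a = g ∘ b ->
    exists! h : Hom A P, p ∘ h = a /\ q ∘ h = b.

Definition trivial_fibration {Y X : Eff} (F : Hom Y X) : Prop :=
  forall (A B : Eff) (m : Hom A B), mono m ->
  forall (u : Hom A Y) (v : Hom B X), F ∘ u = v ∘ m ->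
  exists d : Hom B Y, d ∘ m = u /\ F ∘ d = v.

Definition ceq {S : Type} (x y : S) : pset := fun _ => x = y.

Lemma nabla_sym (S : Type) : ent (fun '(x, y) => @ceq S x y) (fun '(x, y) => ceq y x).
Proof. exists Id. intros [x y] n H. now apply r_id. Qed.

Lemma nabla_trans (S : Type) :
  ent (fun '(x, y, z) => pand (@ceq S x y) (ceq y z)) (fun '(x, y, z) => ceq x z).
Proof.
  exists Id. intros [[x y] z] n [H H']. apply r_id. unfold ceq in *. congruence.
Qed.

Definition nabla (S : Type) : Eff := MkEff S ceq (nabla_sym S) (nabla_trans S).

Section NablaMap.
Context {S T : Type} (f : S -> T).

Definition graph (x : nabla S) (y : nabla T) : pset := ceq (f x) y.

Lemma graph_strict : strict graph.
Proof. exists Id. intros [x y] n H. apply r_id. now split. Qed.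

Lemma graph_ext : extensional graph.
Proof.
  exists Id. intros [[[x y] x'] y'] n (H & H1 & H2). apply r_id.
  unfold graph, ceq in *; simpl in *; unfold ceq in *. congruence.
Qed.

Lemma graph_sv : single_valued graph.
Proof.
  exists Id. intros [[x y] y'] n (H & H'). apply r_id.
  unfold graph, ceq in *; simpl in *; unfold ceq in *. congruence.
Qed.

Lemma graph_total : total graph.
Proof. exists Id. intros x n _. apply r_id. now exists (f x). Qed.

Definition nabla_map : Hom (nabla S) (nabla T) :=
  cls (MkFunRel graph graph_strict graph_ext graph_sv graph_total).
End NablaMap.

Definition one : Eff := nabla unit.

Definition Gamma (X : Eff) : Type := Hom one X.

Definition Gamma_map {X Y : Eff} (f : Hom X Y) : Gamma X -> Gamma Y := fun g => f ∘ g.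

(* The global element [g] is the one named by [x]; independent of the chosen
   representative of [g]. *)
Definition names {X : Eff} (g : Gamma X) (x : X) : Prop :=
  exists G : FunRel one X, g G /\ exists k, G tt x k.

Section Unit.
Context (X : Eff).

Definition eta_rel (x : X) (g : nabla (Gamma X)) : pset :=
  fun n => eqv x x n /\ names g x.

Lemma names_cls (G : FunRel one X) x : names (cls G) x <-> exists k, G tt x k.
Proof.
  split.
  - intros (G' & [_ [e H]] & k & Hk).
    destruct (H (tt, x) k Hk) as (m & _ & Hm). now exists m.
  - intros H. exists G. split; trivial. apply fr_equiv_refl.
Qed.

Lemma names_sv (g h : Gamma X) x y n :
  names g x -> names h y -> eqv x y n -> g = h.
Proof.
  destruct (hom_cls g) as [G ->], (hom_cls h) as [H ->].
  rewrite !names_cls. intros [k Hk] [l Hl] E. apply cls_eq.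
  apply (r_const _ 0) in E.
  destruct (use_sv G) as [sg SG], (use_ext G) as [eg EG].
  destruct (use_sv H) as [sh SH], (use_ext H) as [eh EH].
  destruct (use_sym X) as [s Hs], (use_trans X) as [t Ht].
  assert (forall n, realizes (Const k) n (G tt x)) as HG by (intros; now apply r_const).
  assert (forall n, realizes (Const l) n (H tt y)) as HH by (intros; now apply r_const).
  destruct E as (e & _ & E). clear n.
  assert (forall n, realizes (Const e) n (eqv x y)) as HE by (intros; now apply r_const).
  assert (forall n, realizes Zero n (@eqv one tt tt)) as HU by (intros; now exists 0).
  split; rstart; match goal with u : car one |- _ => destruct u end.
  - eapply EH; [apply HH|apply HU|].
    eapply Ht; [apply Hs, HE|]. eapply SG; [apply HG|apply Hn].
  - eapply EG; [apply HG|apply HU|].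
    eapply Ht; [apply HE|]. eapply SH; [apply HH|apply Hn].
Qed.

Lemma names_ext (g : Gamma X) x x' n : names g x -> eqv x x' n -> names g x'.
Proof.
  destruct (hom_cls g) as [G ->]. rewrite !names_cls. intros [k Hk] E.
  apply (r_const _ 0) in E. apply (r_const _ 0) in Hk.
  destruct (use_ext G) as [eg EG].
  assert (realizes Zero 0 (@eqv one tt tt)) as HU by now exists 0.
  destruct (EG _ _ _ _ _ _ _ _ Hk HU E) as (m & _ & Hm). now exists m.
Qed.

Lemma names_ex x k : eqv x x k -> exists g : Gamma X, names g x.
Proof.
  intros E.
  assert (forall m, realizes (Const k) m (eqv x x)) as HE by (intros; now apply r_const).
  destruct (use_sym X) as [s Hs], (use_trans X) as [t Ht], (use_refl X) as (l & r & Hr).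
  assert (forall n, realizes Zero n (@eqv one tt tt)) as HU by (intros; now exists 0).
  unshelve eexists (cls (MkFunRel (fun (_ : one) y => eqv x y) _ _ _ _)).
  - rstart. apply r_pair; [match goal with u : car one |- _ => destruct u end; apply HU|eapply Hr, Hn].
  - rstart. rsplit. eapply Ht; eassumption.
  - rstart. rsplit. eapply Ht; [apply Hs|]; eassumption.
  - rstart. eapply r_ex, HE.
  - apply names_cls. now exists k.
Qed.

Lemma eta_strict : strict eta_rel.
Proof.
  exists (Pair Id Id). intros [x g] n [H _]. apply r_pair; now apply r_id.
Qed.

Lemma eta_ext : extensional eta_rel.
Proof.
  destruct (use_refl X) as (l & r & Hr).
  eexists. intros [[[x g] x'] g'] n ([H N] & H1 & H2).
  simpl in H2; unfold ceq in H2. subst g'.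
  assert (realizes (Comp Fst (Comp Snd Id)) n (eqv x x')) as E.
  { eexists. split; [|exact H1]. simpl. exists (p2 n). split; trivial.
    exists n. split; trivial. exists (p1 n), (p2 n). now rewrite pr_p. }
  apply Hr in E. destruct E as [_ E]. destruct E as (m & Hm & E).
  exists m. split; [exact Hm|]. split; trivial. eapply names_ext; eassumption.
Qed.

Lemma eta_sv : single_valued eta_rel.
Proof.
  exists Id. intros [[x g] g'] n [[E N] [_ N']]. apply r_id.
  exact (names_sv _ _ _ _ _ N N' E).
Qed.

Lemma eta_total : total eta_rel.
Proof.
  exists Id. intros x n E. apply r_id. destruct (names_ex _ _ E) as [g N].
  exists g. now split.
Qed.

Definition eta : Hom X (nabla (Gamma X)) :=
  cls (MkFunRel eta_rel eta_strict eta_ext eta_sv eta_total).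
End Unit.

(* [eta] is natural and universal, hence the unit of Gamma -| nabla. *)
Lemma eta_natural {X Y : Eff} (f : Hom X Y) :
  eta Y ∘ f = nabla_map (Gamma_map f) ∘ eta X.
Proof.
  destruct (hom_cls f) as [F ->]. unfold eta, nabla_map. rewrite !comp_cls. apply cls_eq.
  destruct (use_strict F) as (l & r & HS), (use_total F) as (t & HT).
  assert (forall x y (g : Gamma X) k, F x y k -> names g x ->
            names (Gamma_map (cls F) g) y) as HN.
  { intros x y g k HF. destruct (hom_cls g) as [G ->]. rewrite names_cls.
    intros [j Hj]. unfold Gamma_map. rewrite comp_cls, names_cls.
    exists (pr j k), x. unfold pand. now rewrite p1_pr, p2_pr. }
  split; rstart; cbn in *; unfold rcomp in *; rsplit.
  - pose proof (proj1 (HS _ _ _ _ H)) as HX.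
    destruct H as (k & _ & Hk), H0 as (j & _ & Hj & Nj).
    pose proof HX as (i & _ & Hi).
    destruct (names_ex _ _ _ Hi) as [g Ng].
    eapply r_ex, r_pair with (g := Zero).
    + eapply r_sub; [|exact HX]. intros m Hm. split; [exact Hm|exact Ng].
    + exists 0. split; [reflexivity|]. unfold graph, ceq.
      destruct (HS Id k _ _ (r_id _ _ Hk)) as [_ (e & _ & He)].
      eapply names_sv; eauto.
  - destruct H0 as (_ & _ & <-).
    pose proof H as (j & _ & Hj & Nj).
    assert (realizes (Comp Fst Id) n (eqv c c)) as HX
      by (eapply r_sub; [|exact H]; now intros m [? _]).
    destruct (HT _ _ _ HX) as [y Hy]. eapply r_ex, r_pair; [exact Hy|].
    eapply r_sub; [|eapply HS, Hy]. intros m Hm. split; trivial.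
    destruct Hy as (k & _ & Hk). eapply HN; eauto.
Qed.

Lemma eta_universal {X : Eff} {S : Type} (f : Hom X (nabla S)) :
  exists! a : Gamma X -> S, nabla_map a ∘ eta X = f.
Proof.
  destruct (hom_cls f) as [F ->].
  destruct (use_strict F) as (l & r & HS), (use_total F) as (t & HT).
  destruct (use_sv F) as (v & HV).
  assert (forall x s s' k k', F x s k -> F x s' k' -> s = s') as sv.
  { intros x s s' k k' H H'. apply (r_const _ 0) in H, H'.
    now destruct (HV _ _ _ _ _ _ H H') as (m & _ & Hm). }
  assert (forall x n, eqv x x n -> exists s k, F x s k) as tot.
  { intros x n H. apply (r_const _ 0), HT in H. destruct H as (s & m & _ & H). eauto. }
  assert (forall g : Gamma X, exists x n, eqv x x n /\ names g x) as pt.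
  { intros g. destruct (hom_cls g) as [G ->].
    destruct (use_total G) as [e He], (use_strict G) as (l' & r' & HG).
    destruct (He Zero 0 tt) as [x Hx]; [now exists 0|].
    destruct (HG _ _ _ _ Hx) as [_ (n & _ & Hn)]. exists x, n. split; trivial.
    apply names_cls. destruct Hx as (k & _ & Hk). eauto. }
  assert (forall g : Gamma X, exists s, forall x, names g x ->
            forall s' k, F x s' k -> s' = s) as ch.
  { intros g. destruct (pt g) as (x & n & E & N). destruct (tot x n E) as (s & k & Hk).
    exists s. intros x' N' s' k' Hk'.
    destruct (hom_cls g) as [G ->]. apply names_cls in N, N'.
    destruct N as [i Hi], N' as [j Hj].
    destruct (use_sv G) as [e He], (use_ext F) as [d Hd].
    apply (r_const _ 0) in Hi, Hj, Hk, Hk'.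
    destruct (Hd _ _ _ _ _ _ _ _ Hk (He _ _ _ _ _ _ Hi Hj) (proj2 (HS _ _ _ _ Hk)))
      as (m & _ & Hm).
    destruct Hk' as (m' & _ & Hm'). eapply sv; eauto. }
  assert (exists a : Gamma X -> S,
            forall g x, names g x -> forall s k, F x s k -> s = a g) as [a Ha].
  { exists (fun g => proj1_sig (constructive_indefinite_description _ (ch g))).
    intros g. now destruct (constructive_indefinite_description _ (ch g)). }
  exists a. split.
  - unfold eta, nabla_map. rewrite comp_cls. apply cls_eq.
    split; rstart; cbn in *; unfold rcomp in *; rsplit.
    + destruct H0 as (_ & _ & <-). pose proof H as (j & _ & Hj & Nj).
      assert (realizes (Comp Fst Id) n (eqv c c)) as HX
        by (eapply r_sub; [|exact H]; now intros m [? _]).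
      destruct (HT _ _ _ HX) as [s Hs]. pose proof Hs as (k & _ & Hk).
      rewrite <- (Ha _ _ Nj _ _ Hk). exact Hs.
    + pose proof (proj1 (HS _ _ _ _ Hn)) as HX. pose proof HX as (i & _ & Hi).
      destruct (names_ex _ _ _ Hi) as [g Ng]. destruct Hn as (k & _ & Hk).
      eapply r_ex, r_pair with (g := Zero).
      * eapply r_sub; [|exact HX]. intros m Hm. split; [exact Hm|exact Ng].
      * exists 0. split; [reflexivity|]. symmetry. eapply Ha; eauto.
  - intros b Hb. unfold eta, nabla_map in Hb. rewrite comp_cls in Hb.
    apply cls_eq in Hb. destruct Hb as [[e H] _]. extensionality g.
    destruct (pt g) as (x & n & E & N).
    destruct (H (x, b g) (pr n 0)) as (m & _ & Hm).
    + exists g. unfold pand. rewrite p1_pr. now repeat split.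
    + symmetry. eapply Ha; eauto.
Qed.

Definition nn_separated (Y : Eff) : Prop :=
  exists phi : code, forall (y y' : Y) (n m : nat),
    (exists k, eqv y y' k) -> eqv y y n -> eqv y' y' m ->
    exists v, eval phi (pr n m) v /\ eqv y y' v.

(* [P] is the pullback of nabla Z and X over nabla (Gamma X), with projections
   [S] and [T]; being given by its universal property, it is determined by [Z]
   and [alpha] up to isomorphism over [X]. *)
Definition uniform {Y X : Eff} (F : Hom Y X) : Prop :=
  exists (Z : Type) (alpha : Z -> Gamma X)
         (P : Eff) (S : Hom P X) (T : Hom P (nabla Z)),
    is_pullback (eta X) (nabla_map alpha) S T /\
    exists R : Hom P Y, epi R /\ F ∘ R = S.

(* Main.v *)
Require Import Defs.

(** Take [Z := Gamma Y] and [alpha := Gamma F], and let [P] be the pullback of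
    [nabla (Gamma F)] along [eta X].  Naturality of [eta] gives a comparison map
    [m : Y -> P] over [X], which is monic as soon as [eta Y] is, that is, when
    [Y] is separated.  Lifting the identity of [Y] along [m] yields a retraction
    [R : P -> Y] of [m] over [X], and a retraction is an epimorphism. *)

(** * Cancellation for epimorphisms and monomorphisms *)

Lemma split_epi {X Y : Eff} (r : Hom X Y) (s : Hom Y X) : r ∘ s = hid Y -> epi r.
Proof.
  intros E W g h H.
  rewrite <- (comp_id_r g), <- (comp_id_r h), <- E, !comp_assoc. now rewrite H.
Qed.

Lemma mono_of_comp {X Y Z : Eff} (g : Hom Y Z) (f : Hom X Y) : mono (g ∘ f) -> mono f.
Proof.
  intros M W a b H. apply M. rewrite <- !comp_assoc. now rewrite H.
Qed.

Lemma use_refl_l (X : Eff) : exists l, forall c n (x y : X),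
  realizes c n (eqv x y) -> realizes (Comp l c) n (eqv x x).
Proof. destruct (use_refl X) as (l & r & H). exists l.
  intros c n x y E. now apply (H c n x y). Qed.

Lemma use_refl_r (X : Eff) : exists r, forall c n (x y : X),
  realizes c n (eqv x y) -> realizes (Comp r c) n (eqv y y).
Proof. destruct (use_refl X) as (l & r & H). exists r.
  intros c n x y E. now apply (H c n x y). Qed.

(** * The unit at a separated object *)

Lemma names_connected {X : Eff} (g : Gamma X) x y :
  names g x -> names g y -> exists k, eqv x y k.
Proof.
  destruct (hom_cls g) as [G ->]. rewrite !names_cls. intros [i Hi] [j Hj].
  destruct (use_sv G) as [e He]. apply (r_const _ 0) in Hi, Hj.
  destruct (He _ _ _ _ _ _ Hi Hj) as (m & _ & Hm). now exists m.
Qed.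

(** If [G] sends [w] to [y], and [g] is the global element named by [y], the equation yields a value
    [y'] of [H] at [w] that also names [g]. So [y'] and [y] are equal with some realizer,
    separatedness makes one computable, and extensionality of [H] moves [y'] to [y]. *)
Lemma eta_comp_ent {W Y : Eff} (G H : FunRel W Y) :
  nn_separated Y -> eta Y ∘ cls G = eta Y ∘ cls H ->
  ent (fun '(w, y) => G w y) (fun '(w, y) => H w y).
Proof.
  intros [phi Hphi] E. unfold eta in E. rewrite !comp_cls in E.
  apply cls_eq in E. destruct E as [E _]. apply use_ent in E. destruct E as [e He].
  destruct (use_strict G) as (l & r & HG), (use_strict H) as (l' & r' & HH).
  destruct (use_ext H) as [x Hx]. cbn in He. unfold rcomp in He.
  rstart. destruct (HG _ _ _ _ Hn) as [_ HY].
  pose proof HY as (i & _ & Hi). destruct (names_ex _ _ _ Hi) as [g Ng].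
  (* Being named by [g] carries no computational content, so a realizer of [eqv c0 c0] already
     realizes [eta_rel Y c0 g]. *)
  assert (realizes (Comp r Id) n (eta_rel Y c0 g)) as HYg
    by (eapply r_sub; [|exact HY]; intros m Hm; now split).
  pose proof (He _ _ _ _ (r_ex _ _ (fun y => pand (G c y) (eta_rel Y y g)) c0
    (r_pair _ _ _ _ _ Hn HYg))) as K.
  apply r_ex_inv in K. destruct K as [y' K].
  pose proof (r_fst _ _ _ _ K) as K1. pose proof (r_snd _ _ _ _ K) as K2.
  destruct K2 as (j & _ & _ & Nj). destruct (HH _ _ _ _ K1) as [HW HY'].
  eapply Hx; [exact K1|exact HW|].
  eapply r_comp; [|exact (r_pair _ _ _ _ _ HY' HY)].
  intros a [A1 A2]. rewrite <- (pr_p a).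
  (* The realizer from [names_connected] depends on [g] in no uniform way; [phi] needs only its
     existence and computes from the two self-equalities. *)
  apply Hphi; trivial. eapply names_connected; eassumption.
Qed.

Lemma eta_mono (Y : Eff) : nn_separated Y -> mono (eta Y).
Proof.
  intros Sep W g h. destruct (hom_cls g) as [G ->], (hom_cls h) as [H ->].
  intros E. apply cls_eq. split; now apply eta_comp_ent.
Qed.

(** * An explicit pullback of [nabla_map alpha] along [eta X] *)

Section EtaPullback.
Context (X : Eff) {Z : Type} (alpha : Z -> Gamma X).

Definition pb_eqv (p q : X * Z) : pset :=
  fun n => eqv (fst p) (fst q) n /\ snd p = snd q /\ names (alpha (snd p)) (fst p).

Lemma r_pb c n x x' z :
  realizes c n (eqv x x') -> names (alpha z) x -> realizes c n (pb_eqv (x, z) (x', z)).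
Proof. intros H N. eapply r_sub; [|exact H]. intros m Hm. now repeat split. Qed.

Lemma r_pb_inv c n x x' z z' : realizes c n (pb_eqv (x, z) (x', z')) ->
  realizes c n (eqv x x') /\ z = z' /\ names (alpha z) x /\ names (alpha z) x'.
Proof.
  intros (m & Hm & E & Ez & N); cbn in *.
  pose proof (names_ext _ _ _ _ _ N E). repeat apply conj; trivial. now exists m.
Qed.

Ltac pb_split := rsplit; repeat match goal with
  | H : realizes _ _ (pb_eqv _ _) |- _ =>
      apply r_pb_inv in H; destruct H as (H & ? & ? & ?); subst
  | H : realizes _ _ (ceq _ _) |- _ => destruct H as (? & ? & H); unfold ceq in H; subst
  end.

Lemma pb_sym : ent (fun '(p, q) => pb_eqv p q) (fun '(p, q) => pb_eqv q p).
Proof.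
  destruct (use_sym X) as [s Hs]. rstart. pb_split. apply r_pb; [|assumption].
  apply Hs; eassumption.
Qed.

Lemma pb_trans : ent (fun '(p, q, r) => pand (pb_eqv p q) (pb_eqv q r))
                     (fun '(p, q, r) => pb_eqv p r).
Proof.
  destruct (use_trans X) as [t Ht]. rstart. pb_split. apply r_pb; [|assumption].
  eapply Ht; eassumption.
Qed.

Definition eta_pullback : Eff := MkEff (X * Z) pb_eqv pb_sym pb_trans.

Definition pb_fst_rel (p : eta_pullback) (x : X) : pset :=
  fun n => eqv (fst p) x n /\ names (alpha (snd p)) (fst p).

(** Equality in [nabla Z] has no informative realizers; going through [pb_eqv] makes each realizer
    also witness that [p] exists, as strictness demands. *)
Definition pb_snd_rel (p : eta_pullback) (z : nabla Z) : pset := pb_eqv p (fst p, z).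

Lemma r_pb_fst c n x z x' : realizes c n (pb_fst_rel (x, z) x') <->
  realizes c n (eqv x x') /\ names (alpha z) x.
Proof.
  split.
  - intros (m & Hm & E & N); cbn in *. split; trivial. now exists m.
  - intros [H N]. eapply r_sub; [|exact H]. intros m Hm. now split.
Qed.

Ltac pb_rel_split := pb_split; repeat match goal with
  | H : realizes _ _ (pb_fst_rel _ _) |- _ => apply r_pb_fst in H; destruct H as [H ?]
  | H : realizes _ _ (pb_snd_rel _ _) |- _ =>
      apply r_pb_inv in H; destruct H as (H & ? & ? & ?); subst
  end.

Ltac pb_start := rstart; cbn in *;
  repeat match goal with i : prod _ _ |- _ => destruct i end; pb_rel_split.

Lemma pb_fst_strict : strict pb_fst_rel.
Proof.
  destruct (use_refl_l X) as [l Hl], (use_refl_r X) as [r Hr]. pb_start.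
  apply r_pair; [apply r_pb; trivial; eapply Hl|eapply Hr]; eassumption.
Qed.

Lemma pb_fst_ext : extensional pb_fst_rel.
Proof.
  destruct (use_sym X) as [s Hs], (use_trans X) as [t Ht]. pb_start.
  apply r_pb_fst. split; trivial.
  eapply Ht; [|eassumption]. eapply Ht; [apply Hs|]; eassumption.
Qed.

Lemma pb_fst_sv : single_valued pb_fst_rel.
Proof.
  destruct (use_sym X) as [s Hs], (use_trans X) as [t Ht]. pb_start.
  eapply Ht; [apply Hs|]; eassumption.
Qed.

Lemma pb_fst_total : total pb_fst_rel.
Proof. pb_start. eapply r_ex, r_pb_fst. split; eassumption. Qed.

Definition fr_pb_fst : FunRel eta_pullback X :=
  MkFunRel pb_fst_rel pb_fst_strict pb_fst_ext pb_fst_sv pb_fst_total.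

Lemma pb_snd_strict : strict pb_snd_rel.
Proof.
  pb_start. apply r_pair; [now apply r_pb; eauto|]. now apply (r_const 0).
Qed.

Lemma pb_snd_ext : extensional pb_snd_rel.
Proof.
  destruct (use_refl_r X) as [r Hr]. pb_start.
  apply r_pb; trivial. eapply Hr; eassumption.
Qed.

Lemma pb_snd_sv : single_valued pb_snd_rel.
Proof. pb_start. now apply (r_const 0). Qed.

Lemma pb_snd_total : total pb_snd_rel.
Proof. pb_start. eapply r_ex, r_pb; eassumption. Qed.

Definition fr_pb_snd : FunRel eta_pullback (nabla Z) :=
  MkFunRel pb_snd_rel pb_snd_strict pb_snd_ext pb_snd_sv pb_snd_total.

(** Both composites send an existing pair [(x, z)] to [alpha z]: if a point equal to [x] names [g],
    then [names_sv] forces [g = alpha z]. *)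
Lemma pb_square : eta X ∘ cls fr_pb_fst = nabla_map alpha ∘ cls fr_pb_snd.
Proof.
  unfold eta, nabla_map. rewrite !comp_cls. apply cls_eq.
  destruct (use_refl_l X) as [l Hl].
  split; rstart; cbn in *; unfold rcomp in *; cbn in *;
    repeat match goal with i : prod _ _ |- _ => destruct i end; pb_rel_split.
  - pose proof H as (i & _ & E). destruct H0 as (k & _ & _ & N).
    rewrite <- (names_sv X _ _ _ _ _ H1 N E).
    eapply r_ex, r_pair; [apply r_pb; [eapply Hl; exact H|exact H1]|].
    now apply (r_const 0).
  - destruct H0 as (? & _ & <-).
    eapply r_ex, r_pair; [apply r_pb_fst; split; eassumption|].
    eapply r_sub; [|exact H]. intros m Hm. now split.
Qed.

(** * Maps into the pullback: existence and uniqueness *)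

Section Pairing.
Context {A : Eff} (a : FunRel A X) (b : FunRel A (nabla Z))
        (square : eta X ∘ cls a = nabla_map alpha ∘ cls b).

(** By the square, [eta X ∘ cls a] also relates [t] to [alpha z], so some value [x'] of [a] at [t]
    names [alpha z]; single-valuedness of [a] makes [x'] equal to [x]. *)
Lemma pairing_names t x z j k : a t x j -> b t z k -> names (alpha z) x.
Proof.
  intros Ha Hb. unfold eta, nabla_map in square. rewrite !comp_cls in square.
  apply cls_eq in square. destruct square as [_ [e E]].
  (* The [0] is arbitrary: every number realizes a true instance of [graph]. *)
  destruct (E (t, alpha z) (pr k 0)) as (m & _ & x' & Ha' & _ & N).
  - exists z. unfold pand. rewrite p1_pr. now split.
  - destruct (use_sv a) as [s Hs]. apply (r_const _ 0) in Ha, Ha'.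
    destruct (Hs _ _ _ _ _ _ Ha' Ha) as (i & _ & Hi). eapply names_ext; eassumption.
Qed.

Definition pairing_rel (t : A) (p : eta_pullback) : pset :=
  pand (a t (fst p)) (b t (snd p)).

Lemma r_pairing_names c d n t x z :
  realizes c n (a t x) -> realizes d n (b t z) -> names (alpha z) x.
Proof. intros (? & _ & H) (? & _ & H'). eapply pairing_names; eassumption. Qed.

Lemma r_nabla_sv c d n t z z' :
  realizes c n (b t z) -> realizes d n (b t z') -> z = z'.
Proof.
  destruct (use_sv b) as [s Hs]. intros H H'.
  now destruct (Hs _ _ _ _ _ _ H H') as (? & _ & ?).
Qed.

Lemma pairing_strict : strict pairing_rel.
Proof.
  destruct (use_strict a) as (l & r & Ha). pb_start. unfold pairing_rel in *. cbn in *. rsplit.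
  apply r_pair; [eapply Ha; eassumption|].
  apply r_pb; [eapply Ha|eapply r_pairing_names]; eassumption.
Qed.

Lemma pairing_ext : extensional pairing_rel.
Proof.
  destruct (use_ext a) as [e Ha], (use_ext b) as [f Hb].
  pb_start. unfold pairing_rel in *. cbn in *. rsplit.
  apply r_pair; [eapply Ha; eassumption|].
  eapply Hb; [eassumption|eassumption|]. now apply (r_const 0).
Qed.

Lemma pairing_sv : single_valued pairing_rel.
Proof.
  destruct (use_sv a) as [e Ha]. pb_start. unfold pairing_rel in *. cbn in *. rsplit.
  rewrite (r_nabla_sv _ _ _ _ _ _ H3 H2).
  apply r_pb; [eapply Ha|eapply r_pairing_names]; eassumption.
Qed.

Lemma pairing_total : total pairing_rel.
Proof.
  destruct (use_total a) as [e Ha], (use_total b) as [f Hb]. rstart.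
  destruct (Ha _ _ _ Hn) as [x Hx], (Hb _ _ _ Hn) as [z Hz].
  eapply (r_ex _ _ _ (x, z)), r_pair; eassumption.
Qed.

Definition pairing : FunRel A eta_pullback :=
  MkFunRel pairing_rel pairing_strict pairing_ext pairing_sv pairing_total.

Lemma fst_pairing : cls fr_pb_fst ∘ cls pairing = cls a.
Proof.
  rewrite comp_cls. apply cls_eq.
  destruct (use_ext a) as [e Ha], (use_strict a) as (l & r & Hs), (use_total b) as [f Hb].
  split; rstart; cbn in *; unfold rcomp in *; cbn in *; unfold pairing_rel in *.
  - rsplit. destruct x as [x z]. pb_rel_split. cbn in *.
    eapply Ha; [eassumption|eapply Hs; eassumption|eassumption].
  (* Totality of [b] supplies the missing second coordinate of the intermediate pair. *)
  - destruct (Hs _ _ _ _ Hn) as [HA HX]. destruct (Hb _ _ _ HA) as [z Hz].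
    eapply (r_ex _ _ _ (c0, z)), r_pair; [apply r_pair; eassumption|].
    apply r_pb_fst. split; [eassumption|]. eapply r_pairing_names; eassumption.
Qed.

Lemma snd_pairing : cls fr_pb_snd ∘ cls pairing = cls b.
Proof.
  rewrite comp_cls. apply cls_eq.
  destruct (use_strict a) as (l & r & Ha), (use_strict b) as (l' & r' & Hs).
  destruct (use_total a) as [e He].
  split; rstart; cbn in *; unfold rcomp in *; cbn in *; unfold pairing_rel in *.
  - rsplit. destruct x as [x z]. pb_rel_split. cbn in *. eassumption.
  - destruct (Hs _ _ _ _ Hn) as [HA _]. destruct (He _ _ _ HA) as [x Hx].
    eapply (r_ex _ _ _ (x, c0)), r_pair; [apply r_pair; eassumption|].
    apply r_pb; [eapply Ha; eassumption|]. eapply r_pairing_names; eassumption.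
Qed.
End Pairing.

(** From [h t (x, z)] the two equations give possibly different values of [k] at [t], one with first
    component equal to [x], the other with second component [z]. Single-valuedness of [k] identifies
    their second components, so the first value is equal to [(x, z)]. *)
Lemma pb_jointly_ent {A : Eff} (h k : FunRel A eta_pullback) :
  cls fr_pb_fst ∘ cls h = cls fr_pb_fst ∘ cls k ->
  cls fr_pb_snd ∘ cls h = cls fr_pb_snd ∘ cls k ->
  ent (fun '(t, p) => h t p) (fun '(t, p) => k t p).
Proof.
  rewrite !comp_cls, !cls_eq. intros [E1 _] [E2 _].
  apply use_ent in E1, E2. destruct E1 as [e1 E1], E2 as [e2 E2].
  destruct (use_strict h) as (l & r & Hh), (use_strict k) as (l' & r' & Hk).
  destruct (use_sv k) as [v Hv], (use_ext k) as [e He].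
  rstart. match goal with p : car eta_pullback |- _ => destruct p as [x z] end.
  destruct (Hh _ _ _ _ Hn) as [HA HP]. pose proof HP as HX.
  apply r_pb_inv in HX. destruct HX as (HX & _ & N & _).
  pose proof (E1 _ _ _ _ (r_ex _ _ (fun p => pand (h c p) (pb_fst_rel p x)) (x, z)
    (r_pair _ _ _ _ _ Hn (proj2 (r_pb_fst _ _ _ _ _) (conj HX N))))) as K1.
  pose proof (E2 _ _ _ _ (r_ex _ _ (fun p => pand (h c p) (pb_snd_rel p z)) (x, z)
    (r_pair _ _ _ _ _ Hn HP))) as K2.
  apply r_ex_inv in K1, K2. destruct K1 as [[x1 z1] K1], K2 as [[x2 z2] K2].
  pose proof (r_fst _ _ _ _ K1) as R1. pose proof (r_fst _ _ _ _ K2) as R2.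
  apply r_snd, r_pb_fst in K1. apply r_snd, r_pb_inv in K2.
  destruct K1 as [K1 N1], K2 as (_ & -> & _).
  pose proof (Hv _ _ _ _ _ _ R1 R2) as E. apply r_pb_inv in E.
  destruct E as (_ & -> & _).
  eapply He; [exact R1|eapply Hk; exact R1|]. apply r_pb; [exact K1|exact N1].
Qed.

Lemma pb_jointly_monic {A : Eff} (h k : Hom A eta_pullback) :
  cls fr_pb_fst ∘ h = cls fr_pb_fst ∘ k -> cls fr_pb_snd ∘ h = cls fr_pb_snd ∘ k -> h = k.
Proof.
  destruct (hom_cls h) as [H ->], (hom_cls k) as [K ->]. intros E1 E2.
  apply cls_eq. split; now apply pb_jointly_ent.
Qed.

Lemma eta_pullback_is_pullback :
  is_pullback (eta X) (nabla_map alpha) (cls fr_pb_fst) (cls fr_pb_snd).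
Proof.
  split; [apply pb_square|]. intros A f g E.
  destruct (hom_cls f) as [a ->], (hom_cls g) as [b ->].
  exists (cls (pairing a b E)). split.
  - split; [apply fst_pairing|apply snd_pairing].
  - intros h [H1 H2].
    apply pb_jointly_monic; [rewrite fst_pairing|rewrite snd_pairing]; now symmetry.
Qed.
End EtaPullback.

(** * Lifting against the comparison map *)

Theorem theorem6p9 (X Y : Eff) (F : Hom Y X) :
  nn_separated Y -> trivial_fibration F -> uniform F.
Proof.
  intros Sep TF.
  pose proof (eta_pullback_is_pullback X (Gamma_map F)) as PB.
  exists (Gamma Y), (Gamma_map F), (eta_pullback X (Gamma_map F)).
  eexists _, _. split; [exact PB|].
  destruct PB as [_ U]. destruct (U Y F (eta Y) (eta_natural F)) as (m & [HS HT] & _).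
  (* The lifting square has the identity of [Y] on top and the projection to [X] below; it commutes
     because that projection after [m] is [F]. *)
  destruct (TF _ _ m) with (u := hid Y) (v := cls (fr_pb_fst X (Gamma_map F)))
    as (R & HR & HF).
  (* The second projection after [m] is [eta Y]. *)
  - eapply mono_of_comp. rewrite HT. now apply eta_mono.
  - now rewrite comp_id_r.
  - exists R. split; [|exact HF]. now apply (split_epi R m).
Qed.
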